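(* Let $\theta_1=(a_1,b_1,c_1,\sigma_{\epsilon,1}^2)$ and $\theta_2=(a_2,b_2,c_2,\sigma_{\epsilon,2}^2)$ with real $a_q,b_q,c_q$ and $\sigma_{\epsilon,q}^2>0$ ($q=1,2$). Let $X^{(1)}$ and $X^{(2)}$ be wide-sense stationary fields on $\mathbb{Z}^2$ satisfying, for all $i,j\in\mathbb{Z}$, $$X^{(1)}_{i,j}=a_1X^{(1)}_{i-1,j}+b_1X^{(1)}_{i,j-1}+c_1X^{(1)}_{i-1,j-1}+\epsilon^{(1)}_{i,j},\qquad X^{(2)}_{i,j}=a_2X^{(2)}_{i-1,j}+b_2X^{(2)}_{i,j-1}+c_2X^{(2)}_{i-1,j-1}+\epsilon^{(2)}_{i,j},$$ where, for $q=1,2$, $\{\epsilon^{(q)}_{i,j}\}$ is a collection of uncorrelated zero-mean random variables with $\operatorname{var}\epsilon^{(q)}_{i,j}=\sigma_{\epsilon,q}^2$. If $X^{(1)}$ and $X^{(2)}$ have the same autocovariance function, then there exist $\theta_0\in\Theta$ and $m,n\in\{1,2,3,4\}$ such that $\theta_0$ lies in the domains of $T_m$ and $T_n$ and $$\theta_1=T_m\theta_0,\qquad \theta_2=T_n\theta_0 .$$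
   Context: All random variables are real-valued. A random field is wide-sense stationary if it has finite second moments, constant mean, and $\operatorname{cov}(X_{i,j},X_{i-h_1,j-h_2})$ depends only on $(h_1,h_2)$; its autocovariance function is $\gamma_X(h_1,h_2)=\operatorname{cov}(X_{i,j},X_{i-h_1,j-h_2})$. The parameter set is $\Theta=\{(a,b,c,v)\in\mathbb{R}^4:(1-a-b-c)(1-a+b+c)(1+a-b+c)(1+a+b-c)>0,\ v>0\}$. The (partially defined) maps $T_1,\dots,T_4$ from $\Theta$ to $\Theta$ are $$T_1(a,b,c,\sigma_\epsilon^2)=(a,b,c,\sigma_\epsilon^2),\qquad T_2(a,b,c,\sigma_\epsilon^2)=\left(-\tfrac bc,-\tfrac ac,\tfrac1c,c^{-2}\sigma_\epsilon^2\right)\ (c\ne0),$$ $$T_3(a,b,c,\sigma_\epsilon^2)=\left(\tfrac1a,-\tfrac ca,-\tfrac ba,a^{-2}\sigma_\epsilon^2\right)\ (a\neq0),\qquad T_4(a,b,c,\sigma_\epsilon^2)=\left(-\tfrac cb,\tfrac1b,-\tfrac ab,b^{-2}\sigma_\epsilon^2\right)\ (b\ne0).$$ *)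

(* Defs.v *)
From HB Require Import structures.
From mathcomp Require Import all_boot all_order all_algebra.
From mathcomp Require Import ring.
From mathcomp Require Import all_classical all_reals all_analysis.

Set Implicit Arguments.
Unset Strict Implicit.
Unset Printing Implicit Defensive.

Import Order.TTheory GRing.Theory Num.Theory.
Import numFieldNormedType.Exports.

Local Open Scope classical_set_scope.
Local Open Scope ring_scope.

Section Fields.
Context {d : measure_display} {T : measurableType d} {R : realType}
  (P : probability T R).
Implicit Types X eps : int -> int -> {RV P >-> R}.

Definition wide_sense_stationary X : Prop :=
  [/\ forall i j, (X i j : T -> R) \in Lfun P 2%:E,
      exists m : R, forall i j, ('E_P[X i j] = m%:E)%E
    & forall i j i' j' h1 h2 : int,
        covariance P (X i j) (X (i - h1) (j - h2)) =
        covariance P (X i' j') (X (i' - h1) (j' - h2))].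

(* For a wide-sense stationary field the base point (0, 0) is immaterial. *)
Definition autocovariance X (h1 h2 : int) : \bar R :=
  covariance P (X 0 0) (X (0 - h1) (0 - h2)).

(* Uncorrelated, zero-mean, of variance [v]; no independence is assumed. *)
Definition white_noise (v : R) eps : Prop :=
  [/\ forall i j, (eps i j : T -> R) \in Lfun P 2%:E,
      forall i j, ('E_P[eps i j] = 0)%E,
      forall i j, ('V_P[eps i j] = v%:E)%E
    & forall i j k l, (i, j) != (k, l) ->
        (covariance P (eps i j) (eps k l) = 0)%E].

(* Equality of random variables is almost sure equality, at each site. *)
Definition autoregression (a b c : R) X eps : Prop :=
  forall i j : int, {ae P, forall w : T,
    X i j w = a * X (i - 1) j w + b * X i (j - 1) w
              + c * X (i - 1) (j - 1) w + eps i j w}.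

End Fields.

Section ParamSpace.
Context {R : realType}.

(* [(a, b, c, v)], with [v] the variance of the innovations. *)
Definition param : Type := (R * R * R * R)%type.

Definition Theta : set param := [set theta |
  let: (a, b, c, v) := theta in
  0 < (1 - a - b - c) * (1 - a + b + c) * (1 + a - b + c) * (1 + a + b - c)
  /\ 0 < v].

Definition T1 (theta : param) : param := theta.

Definition T2 (theta : param) : param :=
  let: (a, b, c, v) := theta in (- (b / c), - (a / c), c^-1, c ^- 2 * v).

Definition T3 (theta : param) : param :=
  let: (a, b, c, v) := theta in (a^-1, - (c / a), - (b / a), a ^- 2 * v).

Definition T4 (theta : param) : param :=
  let: (a, b, c, v) := theta in (- (c / b), b^-1, - (a / b), b ^- 2 * v).

(* Indices are shifted by one: [0, 1, 2, 3 : 'I_4] stand for T1, T2, T3, T4.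
   [Tmap k] is meaningful only on [Tdom k]. *)
Definition Tmap (k : 'I_4) : param -> param :=
  tnth [tuple T1; T2; T3; T4] k.

Definition Tdom (k : 'I_4) : set param :=
  Theta `&` tnth [tuple setT;
                        [set theta | let: (a, b, c, v) := theta in c != 0];
                        [set theta | let: (a, b, c, v) := theta in a != 0];
                        [set theta | let: (a, b, c, v) := theta in b != 0]] k.

Lemma Tmap_Theta (k : 'I_4) (theta : param) :
  Tdom k theta -> Theta (Tmap k theta).
Proof.
have sq (x u : R) : x != 0 -> 0 < u -> 0 < x ^- 2 * u.
  by move=> x0 u0; rewrite mulr_gt0// invr_gt0 exprn_even_gt0.
case: k theta => [[|[|[|[|//]]]] lt_k4] [[[a b] c] v] [[D_gt0 v_gt0]];
  rewrite /Tmap !(tnth_nth setT) !(tnth_nth T1) /= => x0; split=> //;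
  try exact: sq.
- by have := sq _ _ x0 (sq _ _ x0 D_gt0); congr (0 < _); field.
- by have := sq _ _ x0 (sq _ _ x0 D_gt0); congr (0 < _); field.
- by have := sq _ _ x0 (sq _ _ x0 D_gt0); congr (0 < _); field.
Qed.

End ParamSpace.

Arguments param R : clear implicits.

(* Main.v *)
(** With [A = 1 - a S1 - b S2 - c S1 S2] the lattice operator of the model and
    [A'] its adjoint, the autocovariance [gamma] solves
    [A A' gamma = v delta].

    The parameter lies in [Theta]: [phi = A' gamma] is the covariance of [X 0 0]
    with the noise, hence square summable by Bessel's inequality, and
    [A phi = v delta].  If the product defining [Theta] were [<= 0], the symbol
    of [A] would vanish at some [(z, w)] with [|z| = |w| = 1]; then, summed over
    a box, [A phi] twisted by the character [z ^ i w ^ j] reduces to boundary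
    terms, so every square shell carries [|phi|]-mass at least a constant.  A
    shell of radius [r] has [O(r)] points, so the squared norm of [phi] dominates
    the harmonic series: a contradiction.

    A common [gamma] gives [v2 A1 A1' delta = v1 A2 A2' delta], and at
    [z, w = 1, -1] the four factors defining [Theta] agree up to sign and the
    common scale [sqrt (v2 / v1)].  An even number of signs changes; modulo a
    global sign the four remaining patterns are exactly T1, ..., T4. *)
Require Import Defs.
From HB Require Import structures.
From mathcomp Require Import all_boot all_order all_algebra.
From mathcomp Require Import ring lra.
From mathcomp Require Import complex.
From mathcomp Require Import all_classical all_reals all_analysis.

Set Implicit Arguments.
Unset Strict Implicit.
Unset Printing Implicit Defensive.

Import Order.TTheory GRing.Theory Num.Theory.
Import numFieldNormedType.Exports.

Local Open Scope classical_set_scope.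
Local Open Scope ring_scope.

(** * Integer intervals and telescoping sums *)

Section Lattice.

(* [-r, r - 1] and [-r, r] *)
Definition cint (r : nat) : seq int :=
  [seq Posz k | k <- iota 0 r] ++ [seq Negz k | k <- iota 0 r].
Definition scint (r : nat) : seq int := Posz r :: cint r.

Lemma cint_uniq r : uniq (cint r).
Proof.
rewrite cat_uniq !map_inj_uniq ?iota_uniq; [|by move=> ? ? []..].
by rewrite andbT; apply/hasPn => x /mapP[k _ ->]; apply/mapP => -[].
Qed.

Lemma scint_uniq r : uniq (scint r).
Proof.
rewrite /= cint_uniq andbT mem_cat; apply/norP; split; apply/mapP => -[k] //.
by rewrite mem_iota => /andP[_ kr] [rk]; move: kr; rewrite rk ltnn.
Qed.

Lemma size_cint r : size (cint r) = r.*2.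
Proof. by rewrite size_cat !size_map size_iota addnn. Qed.

Lemma big_cintS (V : nmodType) (g : int -> V) r :
  \sum_(k <- cint r.+1) g k = \sum_(k <- cint r) g k + g (Posz r) + g (Negz r).
Proof.
rewrite /cint !big_cat !big_map -[in LHS]addn1 !iotaD !big_cat !big_seq1 !add0n.
by rewrite [LHS]addrACA !addrA.
Qed.

Lemma big_scintS (V : nmodType) (g : int -> V) r :
  \sum_(k <- scint r.+1) g k
  = \sum_(k <- scint r) g k + g (Posz r.+1) + g (Negz r).
Proof.
rewrite big_cons big_cintS [in RHS]big_cons (addrC (g (Posz r))).
by rewrite [LHS]addrC -[RHS]addrAC.
Qed.

(** Only two end terms survive: [Negz r] is -r - 1, the site just below [-r, r]. *)
Lemma big_scint_telescope (V : zmodType) (g : int -> V) r :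
  \sum_(k <- scint r) (g k - g (k - 1)) = g (Posz r) - g (Negz r).
Proof.
elim: r => [|r IHr]; first by rewrite /scint big_seq1.
rewrite big_scintS IHr !NegzE -!opprD -!PoszD !addn1.
rewrite (_ : Posz r.+1 - 1 = Posz r) ?subzSS ?subr0//.
by rewrite [X in X + _]addrC !addrA !subrK.
Qed.

Lemma big_scint_pred (V : zmodType) (g : int -> V) r :
  \sum_(k <- scint r) g (k - 1) = \sum_(k <- cint r) g k + g (Negz r).
Proof.
have /eqP := big_scint_telescope g r; rewrite sumrB subr_eq => /eqP gE.
by apply: (addrI (g (Posz r) - g (Negz r))); rewrite -gE big_cons addrACA addNr addr0.
Qed.

End Lattice.

(** * Discrete divergence theorem on a square box *)

Section Flux.

Definition ar_op (R : pzRingType) (a b c : R) (f : int -> int -> R) (i j : int) : R :=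
  f i j - a * f (i - 1) j - b * f i (j - 1) - c * f (i - 1) (j - 1).

(* Corners are counted twice. *)
Definition shell (V : nmodType) (f : int -> int -> V) (r : nat) : V :=
  \sum_(k <- cint r.+1) (f (Posz r) k + f (Negz r) k + (f k (Posz r) + f k (Negz r))).

(** With coefficients summing to 1, the operator is a combination of differences: p and q weight the
    two unit steps, s a diagonal step split into two unit steps. Each difference telescopes over the
    box to its boundary; the split accounts for [*+ 2]. *)
Lemma box_flux_le (C : numDomainType) (p q s : C) (f : int -> int -> C) r :
  p + q + s = 1 ->
  `|\sum_(i <- scint r) \sum_(j <- scint r) ar_op p q s f i j|
    <= (`|p| + `|q| + `|s| *+ 2) * shell (fun i j => `|f i j|) r.
Proof.
move=> pqs1.
set Q := shell _ r.
have Q_split : Q = (\sum_(k <- cint r.+1) `|f (Posz r) k| + \sum_(k <- cint r.+1) `|f (Negz r) k|)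
   + (\sum_(k <- cint r.+1) `|f k (Posz r)| + \sum_(k <- cint r.+1) `|f k (Negz r)|).
  by rewrite /Q /shell -!big_split.
have sumge0 (g : int -> C) : 0 <= \sum_(k <- cint r.+1) `|g k| by rewrite sumr_ge0.
pose D1 := \sum_(j <- scint r) (f (Posz r) j - f (Negz r) j).
pose D2 := \sum_(i <- scint r) (f i (Posz r) - f i (Negz r)).
pose D3 := \sum_(i <- scint r) (f (i - 1) (Posz r) - f (i - 1) (Negz r)).
have scint_le (g : int -> C) :
    \sum_(k <- scint r) `|g k| <= \sum_(k <- cint r.+1) `|g k|.
  by rewrite [leLHS]big_cons big_cintS (addrC `|g _|) lerDl.
(* The shifted range [-r - 1, r - 1] still lies in [cint r.+1], which is [-r - 1, r]. *)
have scint_pred_le (g : int -> C) :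
    \sum_(k <- scint r) `|g (k - 1)| <= \sum_(k <- cint r.+1) `|g k|.
  rewrite (big_scint_pred (fun k => `|g k|)) big_cintS lerD2r lerDl//.
have D1_le : `|D1| <= Q.
  rewrite Q_split ler_wpDr ?addr_ge0// (le_trans (ler_norm_sum _ _ _))//.
  apply: le_trans (lerD (scint_le _) (scint_le _)); rewrite -big_split/=.
  by apply: ler_sum => k _; exact: ler_normB.
have D2_le : `|D2| <= Q.
  rewrite Q_split ler_wpDl ?addr_ge0// (le_trans (ler_norm_sum _ _ _))//.
  apply: le_trans (lerD (scint_le _) (scint_le _)); rewrite -big_split/=.
  by apply: ler_sum => k _; exact: ler_normB.
have D3_le : `|D3| <= Q.
  rewrite Q_split ler_wpDl ?addr_ge0// (le_trans (ler_norm_sum _ _ _))//.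
  apply: le_trans (lerD (scint_pred_le (f^~ _)) (scint_pred_le (f^~ _))).
  by rewrite -big_split/=; apply: ler_sum => k _; exact: ler_normB.
have D1E : D1 = \sum_(i <- scint r) \sum_(j <- scint r) (f i j - f (i - 1) j).
  rewrite exchange_big; apply: eq_bigr => j _ /=.
  by rewrite (big_scint_telescope (f^~ j)).
have D2E : D2 = \sum_(i <- scint r) \sum_(j <- scint r) (f i j - f i (j - 1)).
  by apply: eq_bigr => i _ /=; rewrite big_scint_telescope.
have D3E : D3 = \sum_(i <- scint r) \sum_(j <- scint r) (f (i - 1) j - f (i - 1) (j - 1)).
  by apply: eq_bigr => i _ /=; rewrite big_scint_telescope.
have -> : \sum_(i <- scint r) \sum_(j <- scint r) ar_op p q s f i j
    = p * D1 + q * D2 + s * (D1 + D3).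
  rewrite D1E D2E D3E -big_split/= !mulr_sumr -!big_split/=; apply: eq_bigr => i _.
  rewrite -big_split/= !mulr_sumr -!big_split/=; apply: eq_bigr => j _.
  by rewrite /ar_op -[f i j in LHS]mul1r -pqs1; ring.
rewrite 2!mulrDl; apply: le_trans (ler_normD _ _) _.
apply: lerD; last first.
  rewrite normrM mulrnAl -mulrnAr ler_wpM2l// mulr2n.
  by rewrite (le_trans (ler_normD _ _))// lerD.
by rewrite (le_trans (ler_normD _ _))// !normrM lerD// ler_wpM2l.
Qed.

End Flux.

(** * Divergence of the squared norm when the symbol vanishes on the torus *)

Section NoSquareSummable.
Context {R : realType}.

(** The shells of index below n exhaust the box; the factor 2 pays for the corners. *)
Lemma shell_le_box (f : int -> int -> R) n : (forall i j, 0 <= f i j) ->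
  \sum_(r < n) shell f r <= (\sum_(i <- cint n) \sum_(j <- cint n) f i j) *+ 2.
Proof.
move=> f0; elim: n => [|n IHn]; first by rewrite big_ord0 [X in X *+ _]big_nil mul0rn.
rewrite big_ord_recr/=; apply: le_trans (lerD IHn (lexx _)) _.
have cols : \sum_(i <- cint n) \sum_(j <- cint n) f i j
    + \sum_(k <- cint n.+1) (f (Posz n) k + f (Negz n) k)
    <= \sum_(i <- cint n.+1) \sum_(j <- cint n.+1) f i j.
  rewrite [leRHS]big_cintS -[leRHS]addrA -big_split/= lerD2r; apply: ler_sum => i _.
  by rewrite [leRHS]big_cintS -addrA lerDl addr_ge0.
have rows : \sum_(i <- cint n) \sum_(j <- cint n) f i j
    + \sum_(k <- cint n.+1) (f k (Posz n) + f k (Negz n))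
    <= \sum_(i <- cint n.+1) \sum_(j <- cint n.+1) f i j.
  rewrite [in leLHS]exchange_big [leRHS]exchange_big/=.
  rewrite [leRHS]big_cintS -[leRHS]addrA -big_split/= lerD2r; apply: ler_sum => i _.
  by rewrite [leRHS]big_cintS -addrA lerDl addr_ge0.
by rewrite /shell big_split/= !mulr2n addrACA lerD.
Qed.

Lemma harmonic_unbounded (M : R) : exists n, M < \sum_(r < n) r.+1%:R^-1.
Proof.
apply/not_existsP => leM.
apply: (@dvg_harmonic R); apply: nondecreasing_is_cvgn.
  by apply: nondecreasing_series => k _ _; rewrite invr_ge0.
exists M => _ [n _ <-]; rewrite /series/= big_mkord.
by have /negP := leM n; rewrite -leNgt.
Qed.

(* Cauchy-Schwarz on a shell of size [O(r)] gives it a share [>= const / r] of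
   the squared norm. *)
Lemma shell_lower_bound_unbounded (f : int -> int -> R) (v C : R) :
  0 < v -> (forall r, v <= C * shell (fun i j => `|f i j|) r) ->
  forall M : R, exists n, M < \sum_(i <- cint n) \sum_(j <- cint n) f i j ^+ 2.
Proof.
move=> v0 fC M.
have shell_ge0 r : 0 <= shell (fun i j => `|f i j|) r.
  by rewrite sumr_ge0// => k _; rewrite !addr_ge0.
have C0 : 0 < C.
  rewrite ltNge; apply/negP => C0; have := fC 0%N.
  by rewrite leNgt (le_lt_trans _ v0)// mulr_le0_ge0.
pose K := v ^+ 2 / (16%:R * C ^+ 2).
have K0 : 0 < K by rewrite divr_gt0 ?exprn_gt0 ?mulr_gt0 ?exprn_gt0.
have shellK r : K / r.+1%:R <= shell (fun i j => f i j ^+ 2) r.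
  (* Cauchy-Schwarz in linearised form. A shell sum has 8 (r + 1) terms; this [t] makes their
     constants [(t * 2)^-1], multiplied by C, add up to v / 2, which the left side absorbs. *)
  pose t := 8%:R * C * r.+1%:R / v.
  have t0 : 0 < t by rewrite divr_gt0// !mulr_gt0.
  have amgm (x : R) : `|x| <= t / 2 * x ^+ 2 + (t * 2)^-1.
    rewrite -subr_ge0 (_ : _ - _ = (t * `|x| - 1) ^+ 2 / (t * 2)).
      by rewrite divr_ge0 ?sqr_ge0// mulr_ge0 ?ltW.
    by rewrite -(real_normK (num_real x)); field; rewrite lt0r_neq0.
  have : shell (fun i j => `|f i j|) r
      <= t / 2 * shell (fun i j => f i j ^+ 2) r + (t * 2)^-1 *+ (8 * r.+1).
    rewrite /shell mulr_sumr (_ : (8 * r.+1 = 4 * size (cint r.+1))%N); last first.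
      by rewrite size_cint -muln2 mulnCA mulnC.
    rewrite mulrnA -(count_predT (cint _)) -iter_addr_0 -big_const_seq.
    rewrite -big_split/=; apply: ler_sum => k _.
    rewrite (le_trans (lerD (lerD (amgm _) (amgm _)) (lerD (amgm _) (amgm _))))//.
    by rewrite le_eqVlt; apply/orP; left; apply/eqP; ring.
  move=> /(ler_wpM2l (ltW C0))/(le_trans (fC r)).
  move: (shell _ r) => S le_vS.
  have -> : K / r.+1%:R = v ^+2 / (16%:R * C ^+ 2 * r.+1%:R).
    by rewrite /K -mulrA -invfM.
  rewrite ler_pdivrMr ?mulr_gt0 ?exprn_gt0//.
  move: le_vS; rewrite -[_ *+ (8 * _)%N]mulr_natr natrM /t.
  have r0 : 0 < r.+1%:R :> R by [].
  move: (r.+1%:R : R) r0 => N N0.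
  have -> : C * (8%:R * C * N / v / 2 * S + (8%:R * C * N / v * 2)^-1 * (8%:R * N))
      = 4%:R * C ^+ 2 * N * S / v + v / 2.
    by field; rewrite !lt0r_neq0.
  rewrite -lerBlDr (_ : v - v / 2 = v / 2); last by field.
  by rewrite ler_pdivlMr// => le_vS; nra.
(* Doubling M offsets the factor 2 of [shell_le_box]. *)
have [n Mn] := harmonic_unbounded ((M *+ 2) / K).
exists n; rewrite -(ltr_pMn2r (ltn0Sn 1)).
apply: lt_le_trans (shell_le_box _ _); last by move=> i j; exact: sqr_ge0.
rewrite ltr_pdivrMr// in Mn; apply: lt_le_trans Mn _.
by rewrite mulr_suml; apply: ler_sum => r _; rewrite mulrC.
Qed.

Lemma torus_zero_unbounded (a b c v : R) (z w : R[i]) (f : int -> int -> R) :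
  0 < v -> `|z| = 1 -> `|w| = 1 ->
  a%:C%C * z + b%:C%C * w + c%:C%C * z * w = 1 ->
  (forall i j, ar_op a b c f i j = if (i, j) == (0, 0) then v else 0) ->
  forall M : R, exists n, M < \sum_(i <- cint n) \sum_(j <- cint n) f i j ^+ 2.
Proof.
move=> v0 z1 w1 zw fE.
have z0 : z != 0 by rewrite -normr_eq0 z1 oner_eq0.
have w0 : w != 0 by rewrite -normr_eq0 w1 oner_eq0.
have unit_exp (u : R[i]) (k : int) : `|u| = 1 -> `|u ^ k| = 1.
  by move=> u1; case: k => k; rewrite /exprz ?normfV normrX u1 expr1n ?invr1.
have normC (x : R) : `|x%:C%C| = `|x|%:C%C.
  by rewrite normc_def/= expr0n addr0 sqrtr_sqr.
apply: (@shell_lower_bound_unbounded _ v (`|a| + `|b| + `|c| *+ 2)) => // r.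
(* The twist turns the coefficients into a z, b w, c z w, whose sum is 1, and leaves all moduli,
   hence the shell sums, unchanged. *)
pose g i j : R[i] := (f i j)%:C%C * (z ^ i * w ^ j).
have gE i j : ar_op (a%:C%C * z) (b%:C%C * w) (c%:C%C * z * w) g i j =
    if (i, j) == (0, 0) then v%:C%C else 0.
  transitivity ((ar_op a b c f i j)%:C%C * (z ^ i * w ^ j)); last first.
    by rewrite fE; case: eqP => [[-> ->]|_]; rewrite ?expr0z ?mulr1// mul0r.
  rewrite /ar_op /g.
  have -> : z ^ i = z * z ^ (i - 1) by rewrite -{1}(subrK 1 i) expfzDr// expr1z mulrC.
  have -> : w ^ j = w * w ^ (j - 1) by rewrite -{1}(subrK 1 j) expfzDr// expr1z mulrC.
  by rewrite !rmorphB !rmorphM /=; ring.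
have := box_flux_le g r zw.
have -> : \sum_(i <- scint r) \sum_(j <- scint r)
    ar_op (a%:C%C * z) (b%:C%C * w) (c%:C%C * z * w) g i j = v%:C%C.
  have zero_in : 0 \in scint r.
    by case: r => [|r]; rewrite in_cons ?eqxx// mem_cat map_f ?orbT// mem_iota.
  rewrite (bigD1_seq 0) ?scint_uniq//= (bigD1_seq 0) ?scint_uniq//= gE eqxx.
  rewrite big1 ?big1 ?addr0//= => [i i0|j j0].
    by rewrite big1// => j _; rewrite gE xpair_eqE (negbTE i0).
  by rewrite gE xpair_eqE (negbTE j0) andbF.
have -> : shell (fun i j => `|g i j|) r = (shell (fun i j => `|f i j|) r)%:C%C.
  rewrite /shell rmorph_sum; apply: eq_bigr => k _; rewrite /g !rmorphD/=.
  by rewrite !normrM !unit_exp// !mulr1 !normC.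
rewrite !normrM z1 w1 !mulr1 !normC (ger0_norm (ltW v0)) -rmorphMn -!rmorphD -rmorphM.
by rewrite lecR.
Qed.

End NoSquareSummable.

(** * Zeros of the symbol on the torus *)

Section TorusZero.
Context {R : realType}.

(** Solving for w gives w = (1 - a z) / (b + c z), so z must make both moduli equal. The product
    equals K ^ 2 - L ^ 2, and its being nonpositive leaves room for a real part of z in [-1, 1]. *)
Lemma symbol_torus_zero (a b c : R) :
  (1 - a - b - c) * (1 - a + b + c) * (1 + a - b + c) * (1 + a + b - c) <= 0 ->
  exists z w : R[i], [/\ `|z| = 1, `|w| = 1 &
    a%:C%C * z + b%:C%C * w + c%:C%C * z * w = 1].
Proof.
set K := 1 + a ^+ 2 - b ^+ 2 - c ^+ 2; set L := 2 * (a + b * c).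
(* [|1 - a z| = |b + c z|] iff [K = L Re z] *)
rewrite (_ : _ * _ = K ^+ 2 - L ^+ 2); last by rewrite /K /L; ring.
rewrite subr_le0 => KL.
have [t t1 tKL] : exists2 t, t ^+ 2 <= 1 & K = L * t.
  have [L0|L0] := eqVneq L 0.
    exists 0; first by rewrite expr0n.
    by move: KL; rewrite mulr0 L0 expr0n/= real_exprn_even_le0 ?num_real//= => /eqP.
  exists (K / L); last by rewrite mulrCA divff ?mulr1.
  by rewrite expr_div_n ler_pdivrMr ?exprn_even_gt0// mul1r.
pose u := Num.sqrt (1 - t ^+ 2).
have u2 : u ^+ 2 = 1 - t ^+ 2 by rewrite sqr_sqrtr// subr_ge0.
pose z : R[i] := (t +i* u)%C.
have normE (x y : R) : `|(x +i* y)%C| = (Num.sqrt (x ^+ 2 + y ^+ 2))%:C%C.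
  by rewrite normc_def.
have z1 : `|z| = 1 by rewrite normE u2 addrCA subrr addr0 sqrtr1.
have modE : `|1 - a%:C%C * z| = `|b%:C%C + c%:C%C * z|.
  have -> : 1 - a%:C%C * z = ((1 - a * t) +i* (- (a * u)))%C.
    by apply/eqP; rewrite eq_complex/=; apply/andP; split; apply/eqP; ring.
  have -> : b%:C%C + c%:C%C * z = ((b + c * t) +i* (c * u))%C.
    by apply/eqP; rewrite eq_complex/=; apply/andP; split; apply/eqP; ring.
  rewrite !normE; congr (Num.sqrt _)%:C%C.
  rewrite sqrrN !exprMn u2; apply/eqP; rewrite -subr_eq0.
  rewrite (_ : _ - _ = K - L * t); first by rewrite tKL subrr.
  by rewrite /K /L; ring.
(* If b + c z = 0, equality of moduli forces a z = 1, and any w on the circle will do. *)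
have [s0|s0] := eqVneq (b%:C%C + c%:C%C * z) 0.
  exists z, 1; split=> //; first exact: normr1.
  move/eqP: modE; rewrite s0 normr0 normr_eq0 subr_eq0 => /eqP az1.
  by rewrite !mulr1 -addrA s0 addr0 -az1.
exists z, ((1 - a%:C%C * z) / (b%:C%C + c%:C%C * z)); split => //.
  by rewrite normrM normfV modE divff// normr_eq0.
by rewrite -addrA -mulrDl [X in _ + X]mulrC divfK// addrC subrK.
Qed.

End TorusZero.

(** * From the four squared factors to the maps T1, ..., T4 *)

Section Identification.
Context {R : realType}.

Lemma proportional_spectra (a1 b1 c1 v1 a2 b2 c2 v2 : R) :
  Theta (a1, b1, c1, v1) -> Theta (a2, b2, c2, v2) ->
  v2 * (1 - a1 - b1 - c1) ^+ 2 = v1 * (1 - a2 - b2 - c2) ^+ 2 ->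
  v2 * (1 - a1 + b1 + c1) ^+ 2 = v1 * (1 - a2 + b2 + c2) ^+ 2 ->
  v2 * (1 + a1 - b1 + c1) ^+ 2 = v1 * (1 + a2 - b2 + c2) ^+ 2 ->
  v2 * (1 + a1 + b1 - c1) ^+ 2 = v1 * (1 + a2 + b2 - c2) ^+ 2 ->
  exists n : 'I_4,
    Tdom n (a1, b1, c1, v1) /\ (a2, b2, c2, v2) = Tmap n (a1, b1, c1, v1).
Proof.
move=> Th1; move: (Th1) => [/= D1 v1_gt0] [/= D2 v2_gt0].
(* The sign of the first factor is absorbed into [r], and evenness fixes the fourth sign as
   [p (+) q]. The four factors sum to 4, so adding the equations gives r = 1 or r x = -1 with x one
   of a1, b1, c1. *)
have key (r : R) (p q : bool) : v2 = r ^+ 2 * v1 ->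
    1 - a2 - b2 - c2 = r * (1 - a1 - b1 - c1) ->
    1 - a2 + b2 + c2 = (-1) ^+ p * (r * (1 - a1 + b1 + c1)) ->
    1 + a2 - b2 + c2 = (-1) ^+ q * (r * (1 + a1 - b1 + c1)) ->
    1 + a2 + b2 - c2 = (-1) ^+ (p (+) q) * (r * (1 + a1 + b1 - c1)) ->
    exists n : 'I_4, Tdom n (a1, b1, c1, v1) /\ (a2, b2, c2, v2) = Tmap n (a1, b1, c1, v1).
  have recip (x : R) : r * x = -1 -> x != 0 /\ r = - x^-1.
    move=> rx; have x0 : x != 0.
      by apply/eqP => x0; move/eqP: rx; rewrite x0 mulr0 eq_sym oppr_eq0 oner_eq0.
    by split=> //; rewrite -[r](mulfK x0) rx mulN1r.
  case: p q => -[]; rewrite /= ?expr0 ?expr1 ?mul1r ?mulN1r => v2E E1 E2 E3 E4.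
  - have /recip[x0 rE] : r * c1 = -1 by lra.
    exists (inord 1); rewrite /Tdom /Tmap !(tnth_nth setT) !(tnth_nth T1) !inordK//=.
    split=> //; have -> : a2 = r * b1 by lra.
    have -> : b2 = r * a1 by lra.
    have -> : c2 = - r by lra.
    by rewrite v2E rE; congr (_, _, _, _); field.
  - have /recip[x0 rE] : r * b1 = -1 by lra.
    exists (inord 3); rewrite /Tdom /Tmap !(tnth_nth setT) !(tnth_nth T1) !inordK//=.
    split=> //; have -> : a2 = r * c1 by lra.
    have -> : b2 = - r by lra.
    have -> : c2 = r * a1 by lra.
    by rewrite v2E rE; congr (_, _, _, _); field.
  - have /recip[x0 rE] : r * a1 = -1 by lra.
    exists (inord 2); rewrite /Tdom /Tmap !(tnth_nth setT) !(tnth_nth T1) !inordK//=.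
    split=> //; have -> : a2 = - r by lra.
    have -> : b2 = r * c1 by lra.
    have -> : c2 = r * b1 by lra.
    by rewrite v2E rE; congr (_, _, _, _); field.
  - have rE : r = 1 by lra.
    exists (inord 0); rewrite /Tdom /Tmap !(tnth_nth setT) !(tnth_nth T1) !inordK//=.
    split=> //; move: E1 E2 E3 E4; rewrite v2E rE => E1 E2 E3 E4; rewrite /T1.
    by congr (_, _, _, _); [lra|lra|lra|ring].
have v10 : v1 != 0 by rewrite lt0r_neq0.
pose rho := Num.sqrt (v2 / v1).
have rho2 : rho ^+ 2 = v2 / v1 by rewrite sqr_sqrtr// divr_ge0// ltW.
have v2E : v2 = rho ^+ 2 * v1 by rewrite rho2 divfK.
have signs (x y : R) : v2 * x ^+ 2 = v1 * y ^+ 2 -> exists s : bool, y = (-1) ^+ s * (rho * x).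
  move=> xy; have /eqP : y ^+ 2 = (rho * x) ^+ 2.
    by apply: (mulfI v10); rewrite -xy v2E; ring.
  rewrite eqf_sqr => /orP[]/eqP ->; first by exists false; rewrite mul1r.
  by exists true; rewrite mulN1r.
move=> /signs[s1 E1] /signs[s2 E2] /signs[s3 E3] /signs[s4 E4].
have D2E : (1 - a2 - b2 - c2) * (1 - a2 + b2 + c2) * (1 + a2 - b2 + c2) * (1 + a2 + b2 - c2)
    = (-1) ^+ (s1 (+) s2 (+) s3 (+) s4) * (rho ^+ 4 * ((1 - a1 - b1 - c1)
      * (1 - a1 + b1 + c1) * (1 + a1 - b1 + c1) * (1 + a1 + b1 - c1))).
  by rewrite E1 E2 E3 E4 !signr_addb; ring.
have s_even : s1 (+) s2 (+) s3 (+) s4 = false.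
  move: D2; rewrite D2E; case: (s1 (+) _ (+) _ (+) _) => //.
  by rewrite mulN1r oppr_gt0 ltNge mulr_ge0 ?exprn_even_ge0// ltW.
apply: (key ((-1) ^+ s1 * rho) (s1 (+) s2) (s1 (+) s3)).
- by rewrite exprMn sqrr_sign mul1r.
- by rewrite E1 mulrA.
- by rewrite E2 signr_addb; case: (s1) => /=; ring.
- by rewrite E3 signr_addb; case: (s1) => /=; ring.
- rewrite E4; have -> : s4 = s1 (+) ((s1 (+) s2) (+) (s1 (+) s3)).
    by move: s_even; case: (s1) (s2) (s3) (s4) => -[] [] [].
  by rewrite signr_addb; ring.
Qed.

End Identification.

(** * Commuting lattice operators and comparison of coefficients *)

Section Adjoint.
Context {R : comPzRingType}.
Implicit Types (a b c v : R) (f : int -> int -> R).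

Definition ar_adj a b c f (i j : int) : R :=
  f i j - a * f (i + 1) j - b * f i (j + 1) - c * f (i + 1) (j + 1).

Definition delta v (i j : int) : R := if (i, j) == (0, 0) then v else 0.

Lemma ar_opC a1 b1 c1 a2 b2 c2 f :
  ar_op a1 b1 c1 (ar_op a2 b2 c2 f) = ar_op a2 b2 c2 (ar_op a1 b1 c1 f).
Proof. by apply/funext => i; apply/funext => j; rewrite /ar_op; ring. Qed.

Lemma ar_adjC a1 b1 c1 a2 b2 c2 f :
  ar_adj a1 b1 c1 (ar_adj a2 b2 c2 f) = ar_adj a2 b2 c2 (ar_adj a1 b1 c1 f).
Proof. by apply/funext => i; apply/funext => j; rewrite /ar_adj; ring. Qed.

Lemma ar_op_adjC a1 b1 c1 a2 b2 c2 f :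
  ar_op a1 b1 c1 (ar_adj a2 b2 c2 f) = ar_adj a2 b2 c2 (ar_op a1 b1 c1 f).
Proof.
by apply/funext => i; apply/funext => j; rewrite /ar_op /ar_adj !addrK ?subrK; ring.
Qed.

(** Replace each delta by the other model's equation: both sides become the same four commuting
    operators applied to f. *)
Lemma common_solution_eq a1 b1 c1 v1 a2 b2 c2 v2 f :
  ar_op a1 b1 c1 (ar_adj a1 b1 c1 f) = delta v1 ->
  ar_op a2 b2 c2 (ar_adj a2 b2 c2 f) = delta v2 ->
  ar_op a1 b1 c1 (ar_adj a1 b1 c1 (delta v2)) =
  ar_op a2 b2 c2 (ar_adj a2 b2 c2 (delta v1)).
Proof.
move=> <- <-.
by rewrite -!ar_op_adjC [LHS]ar_opC; rewrite ar_adjC.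
Qed.

(** [common_solution_eq] is read at (0, 0), (1, 0), (0, 1), (1, 1) and (1, -1); up to the symmetry h
    to -h these are all the sites of the 3 by 3 support. *)
Lemma common_solution_coeffs a1 b1 c1 v1 a2 b2 c2 v2 f :
  ar_op a1 b1 c1 (ar_adj a1 b1 c1 f) = delta v1 ->
  ar_op a2 b2 c2 (ar_adj a2 b2 c2 f) = delta v2 ->
  [/\ v2 * (1 + a1 ^+ 2 + b1 ^+ 2 + c1 ^+ 2) = v1 * (1 + a2 ^+ 2 + b2 ^+ 2 + c2 ^+ 2),
      v2 * (b1 * c1 - a1) = v1 * (b2 * c2 - a2),
      v2 * (a1 * c1 - b1) = v1 * (a2 * c2 - b2),
      v2 * c1 = v1 * c2 & v2 * (a1 * b1) = v1 * (a2 * b2)].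
Proof.
move=> f1 f2; have E i j : ar_op a1 b1 c1 (ar_adj a1 b1 c1 (delta v2)) i j
    - ar_op a2 b2 c2 (ar_adj a2 b2 c2 (delta v1)) i j = 0.
  by rewrite (common_solution_eq f1 f2) subrr.
move: (E 0 0) (E 1 0) (E 0 1) (E 1 1) (E 1 (-1)).
rewrite /ar_op /ar_adj /delta !xpair_eqE /= => E00 E10 E01 E11 E1N.
split; apply: subr0_eq.
- by rewrite -[RHS]E00; ring.
- by rewrite -[RHS]E10; ring.
- by rewrite -[RHS]E01; ring.
- by rewrite -[RHS]oppr0 -[in RHS]E11; ring.
- by rewrite -[RHS]E1N; ring.
Qed.

End Adjoint.

(** * Covariance of square-integrable variables and Bessel's inequality *)

Section SecondOrder.
Context {d : measure_display} {T : measurableType d} {R : realType}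
  (P : probability T R).
Implicit Types X Y Z : T -> R.

(** By [covK], [fine] loses nothing on square-integrable variables. *)
Definition cov X Y : R := fine (covariance P X Y).

Lemma Lfun2_Lfun1 X : X \in Lfun P 2%:E -> X \in Lfun P 1%E.
Proof. by apply: Lfun_subset12; exact: fin_num_measure. Qed.

Lemma Lfun2M X Y : X \in Lfun P 2%:E -> Y \in Lfun P 2%:E -> X * Y \in Lfun P 1%E.
Proof. exact: Lfun2_mul_Lfun1. Qed.

Lemma covK X Y : X \in Lfun P 2%:E -> Y \in Lfun P 2%:E ->
  (cov X Y)%:E = covariance P X Y.
Proof.
by move=> X2 Y2; rewrite fineK// covariance_fin_num ?Lfun2M ?Lfun2_Lfun1//.
Qed.

Lemma covC X Y : cov X Y = cov Y X.
Proof. by rewrite /cov covarianceC. Qed.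

Lemma cov_ge0 X : 0 <= cov X X.
Proof. by rewrite /cov fine_ge0// variance_ge0. Qed.

Lemma scale_funE a X : a *: X = a \o* X.
Proof. by apply/funext => x /=; rewrite mulrC. Qed.

Lemma Lfun2BZ a X Y : X \in Lfun P 2%:E -> Y \in Lfun P 2%:E ->
  X - a *: Y \in Lfun P 2%:E.
Proof.
by move=> X2 Y2; rewrite rpredB ?lee1n//= scale_funE Lfun_scale ?ler1n.
Qed.

Lemma covBZr a X Y Z :
  X \in Lfun P 2%:E -> Y \in Lfun P 2%:E -> Z \in Lfun P 2%:E ->
  cov X (Y - a *: Z) = cov X Y - a * cov X Z.
Proof.
move=> X2 Y2 Z2.
have aZ2 : a \o* Z \in Lfun P 2%:E by rewrite Lfun_scale ?ler1n.
apply: EFin_inj; rewrite EFinB EFinM !covK ?Lfun2BZ//.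
rewrite scale_funE -[Y - _]/(Y \- (a \o* Z)) covarianceBr//.
by rewrite covarianceZr ?Lfun2M ?Lfun2_Lfun1.
Qed.

Lemma covBZl a X Y Z :
  X \in Lfun P 2%:E -> Y \in Lfun P 2%:E -> Z \in Lfun P 2%:E ->
  cov (Y - a *: Z) X = cov Y X - a * cov Z X.
Proof. by move=> X2 Y2 Z2; rewrite !(covC _ X) covBZr. Qed.

(** Needed because the autoregression holds only almost surely. *)
Lemma cov_ae_eqr X Y Z :
  X \in Lfun P 2%:E -> Y \in Lfun P 2%:E -> Z \in Lfun P 2%:E ->
  {ae P, forall w, Y w = Z w} -> cov X Y = cov X Z.
Proof.
move=> X2 Y2 Z2 YZ.
have E_eq (W W' : T -> R) : W \in Lfun P 1%E -> W' \in Lfun P 1%E ->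
    {ae P, forall w, W w = W' w} -> ('E_P[W] = 'E_P[W'])%E.
  move=> W1 W1' WW'; rewrite unlock; apply: ae_eq_integral => //.
  - by have /Lfun1_integrable/integrableP[] := W1.
  - by have /Lfun1_integrable/integrableP[] := W1'.
  by apply: filterS WW' => w /= ->.
rewrite /cov !covarianceE ?Lfun2M ?Lfun2_Lfun1//.
rewrite (E_eq Y Z) ?Lfun2_Lfun1// (E_eq (X * Y) (X * Z)) ?Lfun2M//.
by apply: filterS YZ => w /= YZw; rewrite !fctE YZw.
Qed.

(** Induction by deflation: subtracting from X its projection on [e t] lowers v cov(X, X) by cov(X,
    e t) ^ 2 and leaves the coefficients on the other [e i] unchanged. *)
Lemma bessel (I : eqType) (e : I -> T -> R) (v : R) (s : seq I) X :
  0 < v -> (forall i, e i \in Lfun P 2%:E) -> X \in Lfun P 2%:E ->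
  (forall i j, cov (e i) (e j) = if i == j then v else 0) -> uniq s ->
  \sum_(i <- s) cov X (e i) ^+ 2 <= v * cov X X.
Proof.
move=> v0 e2 + eE; elim: s X => [|t s IHs] X X2 /=.
  by rewrite big_nil mulr_ge0 ?cov_ge0// ltW.
move=> /andP[ts /IHs{}IHs]; rewrite big_cons.
pose k := cov X (e t) / v.
have kv : k * v = cov X (e t) by rewrite divfK ?lt0r_neq0.
have Y2 : X - k *: e t \in Lfun P 2%:E by exact: Lfun2BZ.
have := IHs _ Y2.
rewrite covBZl// !covBZr// eE eqxx (covC _ X) -kv.
rewrite (_ : v * _ = v * cov X X - (k * v) ^+ 2); last by ring.
rewrite lerBrDl; apply: le_trans; rewrite lerD2l le_eqVlt; apply/orP; left.
apply/eqP; apply: eq_big_seq => i si; rewrite covBZl// eE.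
case: eqP => [ti|_]; first by rewrite ti si in ts.
by rewrite mulr0 subr0.
Qed.

End SecondOrder.

(** * Yule-Walker equation and membership in Theta *)

Section Process.
Context {d : measure_display} {T : measurableType d} {R : realType}
  (P : probability T R).
Context (a b c v : R) (X eps : int -> int -> {RV P >-> R}).
Hypotheses (v_gt0 : 0 < v) (X_wss : wide_sense_stationary X)
  (eps_wn : white_noise v eps) (X_ar : autoregression a b c X eps).

Let gamma h1 h2 : R := fine (autocovariance X h1 h2).

Let X2 i j : (X i j : T -> R) \in Lfun P 2%:E.
Proof. by case: X_wss. Qed.

Let eps2 i j : (eps i j : T -> R) \in Lfun P 2%:E.
Proof. by case: eps_wn. Qed.

Lemma cov_field i j k l : cov P (X i j) (X k l) = gamma (i - k) (j - l).
Proof.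
rewrite /gamma /autocovariance; have [_ _ stat] := X_wss.
by rewrite -(stat i j) !subKr.
Qed.

Lemma cov_noise i j k l : cov P (eps i j) (eps k l) = delta v (i - k) (j - l).
Proof.
have [_ _ var_eps uncor] := eps_wn; rewrite /delta xpair_eqE !subr_eq0 -xpair_eqE.
case: eqP => [[-> ->]|/eqP/uncor]; last by rewrite /cov => ->.
by rewrite /cov; have := var_eps k l; rewrite /variance => ->.
Qed.

(** The model solved for the noise reads eps = A X almost surely, and covariance with a fixed Y is
    linear. *)
Lemma cov_noiser (Y : T -> R) i j : Y \in Lfun P 2%:E ->
  cov P Y (eps i j) = ar_op a b c (fun k l => cov P Y (X k l)) i j.
Proof.
move=> Y2; rewrite /ar_op -!covBZr ?Lfun2BZ//.
apply: cov_ae_eqr; rewrite ?Lfun2BZ//; apply: filterS (X_ar i j) => w /= Xw.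
by rewrite !fctE Xw /GRing.scale/=; ring.
Qed.

(** The operator acts on the second site, which enters the lag with a minus sign; backward shifts
    thus become forward ones, giving the adjoint. *)
Lemma cov_field_noise i j k l :
  cov P (X i j) (eps k l) = ar_adj a b c gamma (i - k) (j - l).
Proof.
have predE (x y : int) : x - (y - 1) = x - y + 1 by rewrite opprB addrCA addrC.
by rewrite cov_noiser// /ar_op /ar_adj !cov_field !predE.
Qed.

Lemma yule_walker : ar_op a b c (ar_adj a b c gamma) = delta v.
Proof.
apply/funext => i; apply/funext => j.
rewrite -[in RHS](subr0 i) -[in RHS](subr0 j) -cov_noise covC cov_noiser//.
by rewrite /ar_op !(covC _ (eps 0 0)) !cov_field_noise !subr0.
Qed.

Lemma stationary_Theta : Theta (a, b, c, v).
Proof.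
split=> //; rewrite ltNge; apply/negP => /symbol_torus_zero[z [w [z1 w1 zw]]].
pose phi := ar_adj a b c gamma.
have phiE i j : ar_op a b c phi i j = if (i, j) == (0, 0) then v else 0.
  by rewrite yule_walker.
have [n] := torus_zero_unbounded v_gt0 z1 w1 zw phiE (v * cov P (X 0 0) (X 0 0)).
apply/negP; rewrite -leNgt.
(* Reflected indices, so that cov(X 0 0, e h) is phi at h. *)
pose e (h : int * int) : T -> R := eps (- h.1) (- h.2).
have -> : \sum_(i <- cint n) \sum_(j <- cint n) phi i j ^+ 2
    = \sum_(h <- [seq (i, j) | i <- cint n, j <- cint n]) cov P (X 0 0) (e h) ^+ 2.
  rewrite big_allpairs; apply: eq_bigr => i _; apply: eq_bigr => j _.
  by rewrite cov_field_noise !sub0r !opprK.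
apply: bessel => // [h|h k|].
- exact: eps2.
- case: h k => [h1 h2] [k1 k2]; rewrite /e cov_noise /delta !xpair_eqE/=.
  by rewrite !subr_eq0 !eqr_opp.
- by apply: allpairs_uniq => [||[? ?] [? ?]//]; exact: cint_uniq.
Qed.

End Process.

Theorem proposition12 (R : realType)
  (d1 : measure_display) (Omega1 : measurableType d1) (P1 : probability Omega1 R)
  (d2 : measure_display) (Omega2 : measurableType d2) (P2 : probability Omega2 R)
  (a1 b1 c1 v1 a2 b2 c2 v2 : R)
  (X1 eps1 : int -> int -> {RV P1 >-> R})
  (X2 eps2 : int -> int -> {RV P2 >-> R})
  (v1_gt0 : 0 < v1) (v2_gt0 : 0 < v2)
  (X1_wss : wide_sense_stationary X1) (X2_wss : wide_sense_stationary X2)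
  (eps1_wn : white_noise v1 eps1) (eps2_wn : white_noise v2 eps2)
  (X1_ar : autoregression a1 b1 c1 X1 eps1)
  (X2_ar : autoregression a2 b2 c2 X2 eps2)
  (same_acov : forall h1 h2 : int, autocovariance X1 h1 h2 = autocovariance X2 h1 h2) :
  exists (theta0 : param R) (m n : 'I_4),
    [/\ Theta theta0, Tdom m theta0, Tdom n theta0,
        (a1, b1, c1, v1) = Tmap m theta0
      & (a2, b2, c2, v2) = Tmap n theta0].
Proof.
have Th1 := stationary_Theta v1_gt0 X1_wss eps1_wn X1_ar.
have Th2 := stationary_Theta v2_gt0 X2_wss eps2_wn X2_ar.
have yw1 := yule_walker X1_wss eps1_wn X1_ar.
have yw2 := yule_walker X2_wss eps2_wn X2_ar.
have gammaE : (fun h1 h2 => fine (autocovariance X2 h1 h2))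
    = (fun h1 h2 => fine (autocovariance X1 h1 h2)).
  by apply/funext => h1; apply/funext => h2; rewrite same_acov.
rewrite gammaE in yw2.
have [E0 Ez Ew Ezw Ez'] := common_solution_coeffs yw1 yw2.
(* Each squared factor is a linear combination of the five matched coefficients: for instance the
   first is (1 + a^2 + b^2 + c^2) + 2 (b c - a) + 2 (a c - b) - 2 c + 2 a b. *)
have [|||| n [Tn theta2E]] := proportional_spectra Th1 Th2; try lra.
(* Index 0 stands for the identity T1, so the first parameter serves as theta0. *)
by exists (a1, b1, c1, v1), 0, n; split.
Qed.
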